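(* The point transformation $$x'=\frac{e^x}{\sqrt t},\qquad t'=\ln t,\qquad u'=ue^{-2x}$$ maps the equation $$u'_{t'}=\left(\frac{u'_{x'}}{u'}\right)_{x'}+\left(\frac{1}{x'u'}+\frac12x'\right)u'_{x'}$$ into the nonlinear diffusion equation $u_t=\left(\frac{u_x}{u}\right)_x$.
   Context: Subscripts denote partial derivatives. A point transformation $x'=P(x,t)$, $t'=Q(t)$, $u'=R(x,t,u)$ ''maps an equation $E'$ for $u'(x',t')$ into an equation $E$ for $u(x,t)$'' if: whenever $(x,t)\mapsto(P(x,t),Q(t))$ is a diffeomorphism of an open set $D\subset\{t>0\}$ onto an open set $D'$, $u$ is a smooth nowhere vanishing function on $D$, and $u'$ is defined on $D'$ by $u'(P(x,t),Q(t))=R(x,t,u(x,t))$, then $u'$ satisfies $E'$ on $D'$ if and only if $u$ satisfies $E$ on $D$. *)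

(* Defs.v *)
From Stdlib Require Export Reals.
From Coquelicot Require Export Coquelicot.
Open Scope R_scope.

(* Functions of (x,t) are total curried functions R -> R -> R of which only the
   values on an open domain matter: all derivatives below are taken at points
   of that domain, so they depend only on the values there. *)

Definition Dx (u : R -> R -> R) (x t : R) : R := Derive (fun y => u y t) x.
Definition Dt (u : R -> R -> R) (x t : R) : R := Derive (fun s => u x s) t.

Definition has_Dx (u : R -> R -> R) (x t : R) : Prop :=
  ex_derive (fun y => u y t) x.
Definition has_Dt (u : R -> R -> R) (x t : R) : Prop :=
  ex_derive (fun s => u x s) t.

(* On an open set, [ex_diff_n f n] at every point says that all iterated
   partial derivatives of order <= n exist and are continuous. *)
Definition smooth_on (D : R * R -> Prop) (f : R -> R -> R) : Prop :=
  forall n x t, D (x, t) -> ex_diff_n f n x t.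

(* (x,t) |-> (F x t, G x t) is a smooth bijection of D onto D' with smooth
   inverse (x',t') |-> (F' x' t', G' x' t'). *)
Definition diffeomorphism (D D' : R * R -> Prop) (F G : R -> R -> R) : Prop :=
  smooth_on D F /\ smooth_on D G /\
  (forall x t, D (x, t) -> D' (F x t, G x t)) /\
  exists F' G' : R -> R -> R,
    smooth_on D' F' /\ smooth_on D' G' /\
    (forall x' t', D' (x', t') -> D (F' x' t', G' x' t')) /\
    (forall x t, D (x, t) ->
       F' (F x t) (G x t) = x /\ G' (F x t) (G x t) = t) /\
    (forall x' t', D' (x', t') ->
       F (F' x' t') (G' x' t') = x' /\ G (F' x' t') (G' x' t') = t').

(* [E u x t]: the function u satisfies the equation at the point (x,t). *)
Definition equation := (R -> R -> R) -> R -> R -> Prop.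

Definition satisfies_on (E : equation) (D : R * R -> Prop)
    (u : R -> R -> R) : Prop :=
  forall x t, D (x, t) -> E u x t.

(* The transformation is x' = P(x,t), t' = Q(t), u' = S(x,t,u). *)
Definition maps_equation_into (P : R -> R -> R) (Q : R -> R)
    (S : R -> R -> R -> R) (E' E : equation) : Prop :=
  forall (D D' : R * R -> Prop) (u u' : R -> R -> R),
    open D -> (forall x t, D (x, t) -> 0 < t) -> open D' ->
    diffeomorphism D D' P (fun _ t => Q t) ->
    smooth_on D u -> (forall x t, D (x, t) -> u x t <> 0) ->
    (forall x t, D (x, t) -> u' (P x t) (Q t) = S x t (u x t)) ->
    (satisfies_on E' D' u' <-> satisfies_on E D u).

(* [Derive] is total; the equations below therefore also require that the
   derivatives occurring in them exist. *)

(* u_t = (u_x/u)_x *)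
Definition diffusion_equation : equation := fun u x t =>
  let flux := fun y s => Dx u y s / u y s in
  has_Dt u x t /\ has_Dx u x t /\ has_Dx flux x t /\
  Dt u x t = Dx flux x t.

(* u_t = (u_x/u)_x + (1/(x u) + x/2) u_x *)
Definition convection_diffusion_equation : equation := fun u x t =>
  let flux := fun y s => Dx u y s / u y s in
  has_Dt u x t /\ has_Dx u x t /\ has_Dx flux x t /\
  Dt u x t = Dx flux x t + (1 / (x * u x t) + 1 / 2 * x) * Dx u x t.

(* Main.v *)
Require Import Defs.
From Stdlib Require Import Lra.

(** The transformation can be inverted explicitly: [x = ln x' + t'/2],
    [t = exp t'], and since [exp (2 x) = x'^2 t], the new unknown is
    [u' (x',t') = u (x,t) / (x'^2 t)].  Writing [q = u_x / u] for the flux of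
    [u], the chain rule gives at corresponding points

    - [u'_x' = (u_x - 2 u) / (x'^3 t)],
    - [u'_t' = (t u_t + u_x / 2 - u) / (x'^2 t)],
    - [u'_x' / u' = (q - 2) / x'], hence
      [(u'_x' / u')_x' = (q_x - q + 2) / x'^2].

    The convection term [u'_x' / (x' u') = (q - 2) / x'^2] cancels the [- q + 2]
    of the last line, and [x' u'_x' / 2] equals the part
    [(u_x / 2 - u) / (x'^2 t)] of [u'_t'], which comes from [x] moving with [t']
    and from the weight.  What remains of the equation for [u'] is
    [u_t / x'^2 = q_x / x'^2], so the two equations are equivalent point by point
    ([equations_equivalent_at]).  Smoothness of [u] makes every derivative in
    them exist, and continuity of [u_x] is what justifies the chain rule for
    [u'_t'], where both arguments of [u] move ([smooth_differentiable]). *)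

(** * Differentiability on open sets *)

Lemma open_locally_x (D : R * R -> Prop) (x t : R) :
  open D -> D (x, t) -> locally x (fun y => D (y, t)).
Proof.
  intros oD Dxt.
  apply (locally_2d_1d_const_y (fun a b => D (a, b)) x t).
  apply locally_2d_locally.
  apply (filter_imp D); [ now intros [a b] | now apply oD ].
Qed.

Lemma open_locally_t (D : R * R -> Prop) (x t : R) :
  open D -> D (x, t) -> locally t (fun s => D (x, s)).
Proof.
  intros oD Dxt.
  apply (locally_2d_1d_const_x (fun a b => D (a, b)) x t).
  apply locally_2d_locally.
  apply (filter_imp D); [ now intros [a b] | now apply oD ].
Qed.

(** A total derivative only takes existence of the [x]-partial nearby, its
    continuity at the point, and existence of the [t]-partial at the point. *)
Lemma smooth_differentiable (D : R * R -> Prop) (u : R -> R -> R) (x t : R) :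
  open D -> smooth_on D u -> D (x, t) ->
  differentiable_pt_lim u x t (Dx u x t) (Dt u x t).
Proof.
  intros oD su Dxt.
  apply filterdiff_differentiable_pt_lim.
  refine (is_derive_filterdiff u x t (Dx u) (Dt u x t) _ _ _).
  - apply (filter_imp D); [| now apply oD ].
    intros [a b] Dab; simpl.
    apply Derive_correct.
    now destruct (su 1%nat a b Dab) as [_ [ex _]].
  - apply Derive_correct.
    now destruct (su 1%nat x t Dxt) as [_ [_ [ex _]]].
  - destruct (su 1%nat x t Dxt) as [_ [_ [_ [[cx _] _]]]].
    now apply continuity_2d_pt_filterlim in cx.
Qed.

Lemma smooth_is_Dx (D : R * R -> Prop) (u : R -> R -> R) (x t : R) :
  smooth_on D u -> D (x, t) -> is_derive (fun y => u y t) x (Dx u x t).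
Proof.
  intros su Dxt; apply Derive_correct.
  now destruct (su 1%nat x t Dxt) as [_ [ex _]].
Qed.

Lemma smooth_has_Dt (D : R * R -> Prop) (u : R -> R -> R) (x t : R) :
  smooth_on D u -> D (x, t) -> has_Dt u x t.
Proof.
  intros su Dxt.
  now destruct (su 1%nat x t Dxt) as [_ [_ [ex _]]].
Qed.

Lemma smooth_has_Dx_flux (D : R * R -> Prop) (u : R -> R -> R) (x t : R) :
  smooth_on D u -> D (x, t) -> u x t <> 0 ->
  has_Dx (fun y s => Dx u y s / u y s) x t.
Proof.
  intros su Dxt unz.
  destruct (su 2%nat x t Dxt) as [_ [ex [_ [[_ [exx _]] _]]]].
  unfold has_Dx.
  apply (ex_derive_div (fun y => Dx u y t) (fun y => u y t)); assumption.
Qed.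

(** * Derivatives of the transformed function *)

Definition old_x (x' t' : R) : R := ln x' + t' / 2.

(** The relation between [u] and [u'], solved for [u'].  The weight
    [exp (- 2 x)] appears as [1 / (x'^2 t)]. *)
Definition transformed (D D' : R * R -> Prop) (u u' : R -> R -> R) : Prop :=
  forall x' t', D' (x', t') ->
    0 < x' /\ D (old_x x' t', exp t') /\
    u' x' t' = u (old_x x' t') (exp t') / (x' ^ 2 * exp t').

Lemma transformed_is_Dx (D D' : R * R -> Prop) (u u' : R -> R -> R)
    (x' t' : R) :
  open D' -> smooth_on D u -> transformed D D' u u' -> D' (x', t') ->
  is_derive (fun y => u' y t') x'
    ((Dx u (old_x x' t') (exp t') - 2 * u (old_x x' t') (exp t'))
       / (x' ^ 3 * exp t')).
Proof.
  intros oD' su T Dxt.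
  destruct (T x' t' Dxt) as [x'pos [Dold _]].
  pose proof (exp_pos t') as epos.
  apply (is_derive_ext_loc
           (fun y => u (old_x y t') (exp t') / (y ^ 2 * exp t'))).
  { apply (filter_imp (fun y => D' (y, t'))); [| now apply open_locally_x ].
    intros y Dy; symmetry; now apply T. }
  pose proof (smooth_is_Dx D u _ _ su Dold) as du.
  assert (dold : is_derive (fun y => old_x y t') x' (/ x')).
  { unfold old_x; auto_derive; [ assumption | field; lra ]. }
  pose proof (is_derive_comp (fun x => u x (exp t')) (fun y => old_x y t')
                x' _ _ du dold) as dnum.
  assert (dden : is_derive (fun y => y ^ 2 * exp t') x' (2 * x' * exp t')).
  { auto_derive; [ exact I | ring ]. }
  assert (dennz : x' ^ 2 * exp t' <> 0).
  { apply Rmult_integral_contrapositive_currified;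
      [ apply pow_nonzero |]; lra. }
  pose proof (is_derive_div _ _ _ _ _ dnum dden dennz) as d.
  evar_last; [ exact d |].
  unfold scal; simpl; unfold mult; simpl.
  field; lra.
Qed.

(** Along [x' = const] both arguments of [u] vary, at speeds [1/2] and [t]. *)
Lemma transformed_is_Dt (D D' : R * R -> Prop) (u u' : R -> R -> R)
    (x' t' : R) :
  open D -> open D' -> smooth_on D u -> transformed D D' u u' ->
  D' (x', t') ->
  is_derive (fun s => u' x' s) t'
    ((exp t' * Dt u (old_x x' t') (exp t')
      + Dx u (old_x x' t') (exp t') / 2
      - u (old_x x' t') (exp t')) / (x' ^ 2 * exp t')).
Proof.
  intros oD oD' su T Dxt.
  destruct (T x' t' Dxt) as [x'pos [Dold _]].
  pose proof (exp_pos t') as epos.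
  apply (is_derive_ext_loc
           (fun s => u (old_x x' s) (exp s) / (x' ^ 2 * exp s))).
  { apply (filter_imp (fun s => D' (x', s))); [| now apply open_locally_t ].
    intros s Ds; symmetry; now apply T. }
  assert (dold : is_derive (fun s => old_x x' s) t' (1 / 2)).
  { unfold old_x; auto_derive; [ exact I | field ]. }
  assert (dexp : is_derive exp t' (exp t')).
  { auto_derive; [ exact I | ring ]. }
  pose proof (smooth_differentiable D u _ _ oD su Dold) as du.
  apply is_derive_Reals in dold.
  apply is_derive_Reals in dexp.
  pose proof (derivable_pt_lim_comp_2d u _ _ _ _ _ _ _ du dold dexp) as dnum.
  apply is_derive_Reals in dnum.
  assert (dden : is_derive (fun s => x' ^ 2 * exp s) t' (x' ^ 2 * exp t')).
  { auto_derive; [ exact I | ring ]. }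
  assert (dennz : x' ^ 2 * exp t' <> 0).
  { apply Rmult_integral_contrapositive_currified;
      [ apply pow_nonzero |]; lra. }
  pose proof (is_derive_div _ _ _ _ _ dnum dden dennz) as d.
  evar_last; [ exact d |].
  cbv beta; field; lra.
Qed.

Lemma transformed_flux (D D' : R * R -> Prop) (u u' : R -> R -> R)
    (x' t' : R) :
  open D' -> smooth_on D u ->
  (forall x t, D (x, t) -> u x t <> 0) ->
  transformed D D' u u' -> D' (x', t') ->
  Dx u' x' t' / u' x' t' =
  (Dx u (old_x x' t') (exp t') / u (old_x x' t') (exp t') - 2) / x'.
Proof.
  intros oD' su unz T Dxt.
  destruct (T x' t' Dxt) as [x'pos [Dold Eu']].
  pose proof (exp_pos t') as epos.
  pose proof (unz _ _ Dold) as nz.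
  pose proof (transformed_is_Dx D D' u u' x' t' oD' su T Dxt) as dx.
  replace (Dx u' x' t') with
    ((Dx u (old_x x' t') (exp t') - 2 * u (old_x x' t') (exp t'))
       / (x' ^ 3 * exp t'))
    by (symmetry; exact (is_derive_unique _ _ _ dx)).
  rewrite Eu'.
  field; repeat split; lra || assumption.
Qed.

Lemma transformed_flux_is_Dx (D D' : R * R -> Prop) (u u' : R -> R -> R)
    (x' t' : R) :
  open D' -> smooth_on D u ->
  (forall x t, D (x, t) -> u x t <> 0) ->
  transformed D D' u u' -> D' (x', t') ->
  let flux := fun y s => Dx u y s / u y s in
  is_derive (fun y => Dx u' y t' / u' y t') x'
    ((Dx flux (old_x x' t') (exp t') - flux (old_x x' t') (exp t') + 2)
       / x' ^ 2).
Proof.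
  intros oD' su unz T Dxt flux.
  destruct (T x' t' Dxt) as [x'pos [Dold _]].
  apply (is_derive_ext_loc (fun y => (flux (old_x y t') (exp t') - 2) / y)).
  { apply (filter_imp (fun y => D' (y, t'))); [| now apply open_locally_x ].
    intros y Dy; symmetry; now apply (transformed_flux D D'). }
  pose proof (smooth_has_Dx_flux D u _ _ su Dold (unz _ _ Dold)) as exf.
  pose proof (Derive_correct _ _ exf) as df; fold flux in df.
  assert (dold : is_derive (fun y => old_x y t') x' (/ x')).
  { unfold old_x; auto_derive; [ assumption | field; lra ]. }
  pose proof (is_derive_comp (fun x => flux x (exp t')) (fun y => old_x y t')
                x' _ _ df dold) as dcomp.
  pose proof (is_derive_minus _ _ _ _ _ dcomp (is_derive_const 2 x')) as dnum.
  assert (x'nz : x' <> 0) by lra.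
  pose proof (is_derive_div _ _ _ _ _ dnum (is_derive_id x') x'nz) as d.
  evar_last; [ exact d |].
  unfold scal, minus, plus, opp, zero, one; simpl; unfold mult; simpl.
  unfold Dx.
  field; lra.
Qed.

(** * Equivalence of the equations *)

Lemma equations_equivalent_at (D D' : R * R -> Prop) (u u' : R -> R -> R)
    (x' t' : R) :
  open D -> open D' -> smooth_on D u ->
  (forall x t, D (x, t) -> u x t <> 0) ->
  transformed D D' u u' -> D' (x', t') ->
  convection_diffusion_equation u' x' t' <->
  diffusion_equation u (old_x x' t') (exp t').
Proof.
  intros oD oD' su unz T Dxt.
  destruct (T x' t' Dxt) as [x'pos [Dold Eu']].
  pose proof (exp_pos t') as epos.
  pose proof (unz _ _ Dold) as nz.
  pose proof (transformed_is_Dx D D' u u' x' t' oD' su T Dxt) as dx.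
  pose proof (transformed_is_Dt D D' u u' x' t' oD oD' su T Dxt) as dt.
  pose proof (transformed_flux_is_Dx D D' u u' x' t' oD' su unz T Dxt) as df.
  unfold convection_diffusion_equation, diffusion_equation.
  cbv zeta in *.
  set (x := old_x x' t') in *.
  set (t := exp t') in *.
  set (flux := fun y s => Dx u y s / u y s) in *.
  (* The two residuals, left side minus right side, differ by the factor
     [1 / x'^2]. *)
  assert (residual :
    Dt u' x' t'
      - (Dx (fun y s => Dx u' y s / u' y s) x' t'
         + (1 / (x' * u' x' t') + 1 / 2 * x') * Dx u' x' t')
    = (Dt u x t - Dx flux x t) / x' ^ 2).
  { replace (Dt u' x' t') with
      ((t * Dt u x t + Dx u x t / 2 - u x t) / (x' ^ 2 * t))
      by (symmetry; exact (is_derive_unique _ _ _ dt)).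
    replace (Dx u' x' t') with ((Dx u x t - 2 * u x t) / (x' ^ 3 * t))
      by (symmetry; exact (is_derive_unique _ _ _ dx)).
    replace (Dx (fun y s => Dx u' y s / u' y s) x' t') with
      ((Dx flux x t - flux x t + 2) / x' ^ 2)
      by (symmetry; exact (is_derive_unique _ _ _ df)).
    rewrite Eu'.
    unfold flux at 2.
    field; repeat split; lra || assumption. }
  split; intros [_ [_ [_ eq]]]; repeat split.
  - exact (smooth_has_Dt D u _ _ su Dold).
  - eexists; exact (smooth_is_Dx D u _ _ su Dold).
  - exact (smooth_has_Dx_flux D u _ _ su Dold nz).
  - rewrite eq, Rminus_diag in residual.
    replace (Dt u x t) with
      (Dx flux x t + (Dt u x t - Dx flux x t) / x' ^ 2 * x' ^ 2)
      by (field; lra).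
    rewrite <- residual; ring.
  - eexists; exact dt.
  - eexists; exact dx.
  - eexists; exact df.
  - rewrite eq, Rminus_diag in residual.
    apply Rminus_diag_uniq; rewrite residual; field; lra.
Qed.

(** * The change of variables *)

Lemma old_x_new (x t : R) : 0 < t -> old_x (exp x / sqrt t) (ln t) = x.
Proof.
  intros tpos; unfold old_x.
  pose proof (sqrt_lt_R0 t tpos) as spos.
  rewrite ln_div, ln_exp by (apply exp_pos || assumption).
  replace (ln t) with (ln (sqrt t * sqrt t))
    by (rewrite sqrt_sqrt by lra; reflexivity).
  rewrite ln_mult by assumption.
  field.
Qed.

Lemma weight_new (x t : R) :
  0 < t -> exp (- 2 * x) = / ((exp x / sqrt t) ^ 2 * t).
Proof.
  intros tpos.
  pose proof (sqrt_lt_R0 t tpos) as spos.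
  pose proof (exp_pos x) as epos.
  replace (- 2 * x) with (- (x + x)) by ring.
  rewrite exp_Ropp, exp_plus.
  rewrite <- (sqrt_sqrt t) at 2 by lra.
  field; lra.
Qed.

Theorem mainTheorem3 :
  maps_equation_into
    (fun x t => exp x / sqrt t)
    (fun t => ln t)
    (fun x t u => u * exp (- 2 * x))
    convection_diffusion_equation
    diffusion_equation.
Proof.
  intros D D' u u' oD tpos oD' diff su unz Eu'.
  destruct diff as [_ [_ [toD' [F' [G' [_ [_ [toD [_ inv]]]]]]]]].
  assert (T : transformed D D' u u').
  { intros x' t' Dxt.
    specialize (toD x' t' Dxt).
    destruct (inv x' t' Dxt) as [Ex Et].
    pose proof (tpos _ _ toD) as gpos.
    specialize (Eu' _ _ toD).
    rewrite (weight_new _ _ gpos) in Eu'.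
    rewrite Ex, Et in Eu'.
    pose proof (old_x_new (F' x' t') _ gpos) as Eold.
    rewrite Ex, Et in Eold.
    assert (Eexp : exp t' = G' x' t') by now rewrite <- (exp_ln _ gpos), Et.
    rewrite Eold, Eexp.
    repeat split; [| assumption | exact Eu' ].
    enough (0 < exp (F' x' t') / sqrt (G' x' t')) by now rewrite Ex in *.
    apply Rdiv_lt_0_compat; [ apply exp_pos | now apply sqrt_lt_R0 ]. }
  split; intros eq.
  - intros x t Dxt.
    pose proof (tpos _ _ Dxt) as pos.
    pose proof (toD' _ _ Dxt) as Dnew.
    pose proof (proj1 (equations_equivalent_at D D' u u' _ _
                         oD oD' su unz T Dnew) (eq _ _ Dnew)) as E.
    now rewrite old_x_new, exp_ln in E by assumption.
  - intros x' t' Dxt.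
    apply (equations_equivalent_at D D' u u' x' t' oD oD' su unz T Dxt).
    apply eq, (T x' t' Dxt).
Qed.
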